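(* Fix $n>3$. Consider $\mathfrak{S}_n$ as a poset under the Bruhat order, and fix $k\in\{1,\dots,n-1\}$. The number of intervals of the form $[\sigma_k,w]$, with $w\in\mathfrak{S}_n$, that are lattices is $$\begin{cases}4F_{2n-4} & \text{if } k\in\{1,n-1\},\\ 16\,F_{2k-2}\,F_{2(n-k)-2}+F_{2n-5}-F_{2k-3}\,F_{2(n-k)-3} & \text{if } 2\le k\le n-2,\end{cases}$$ where $F_i$ is the $i$th Fibonacci number.
   Context: $\mathfrak{S}_n$ is the symmetric group with Coxeter generators $\sigma_1,\dots,\sigma_{n-1}$, where $\sigma_i$ is the transposition swapping $i$ and $i+1$. A reduced decomposition of $w$ is a word of minimal length in these generators with product $w$. Bruhat order: $v\le w$ if some reduced decomposition of $v$ is a (not necessarily contiguous) subword of a reduced decomposition of $w$. $[v,w]=\{u: v\le u\le w\}$ for $v\le w$. Fibonacci numbers are indexed by $F_0=0$, $F_1=1$. *)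

(* Defs.v *)
From mathcomp Require Import all_boot all_fingroup boolp.

Set Implicit Arguments.
Unset Strict Implicit.
Unset Printing Implicit Defensive.

(* F_0 = 0 and F_1 = 1. *)
Fixpoint fib (n : nat) : nat :=
  if n is n'.+1 then (if n' is n''.+1 then fib n' + fib n'' else 1) else 0.

(* The Coxeter generators are numbered 1, ..., n - 1 as is usual, whereas 'S_n
   acts on {0, ..., n - 1}: the transposition of the i-th and (i + 1)-st points
   exchanges the ordinals i.-1 and i.  For i >= n the value is junk (the
   identity), as it is for i = 0; both are excluded by [is_word]. *)
Definition sigma (n i : nat) : 'S_n :=
  match insub i.-1, insub i with
  | Some a, Some b => tperm a b
  | _, _ => 1%g
  end.

Definition is_word (n : nat) (s : seq nat) : bool := all (fun i => 0 < i < n) s.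

(* In 'S_n, (s * t) x = t (s x).  The opposite convention reverses every word,
   which changes neither lengths nor the subword relation, so the Bruhat order
   does not depend on this choice. *)
Definition word_prod (n : nat) (s : seq nat) : 'S_n :=
  (\prod_(i <- s) sigma n i)%g.

Definition decomposition (n : nat) (s : seq nat) (w : 'S_n) : Prop :=
  is_word n s /\ word_prod n s = w.

Definition reduced_decomposition (n : nat) (s : seq nat) (w : 'S_n) : Prop :=
  decomposition s w /\ forall t, decomposition t w -> size s <= size t.

Definition bruhat (n : nat) (v w : 'S_n) : Prop :=
  exists s t : seq nat,
    [/\ reduced_decomposition s v, reduced_decomposition t w & subseq s t].

Definition bruhat_interval (n : nat) (v w : 'S_n) : {set 'S_n} :=
  [set u | `[< bruhat v u /\ bruhat u w >]].

Section Lattice.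

Variables (T : finType) (le : T -> T -> Prop) (A : {set T}).

Definition is_meet_in (x y m : T) : Prop :=
  [/\ m \in A, le m x, le m y &
      forall z, z \in A -> le z x -> le z y -> le z m].

Definition is_join_in (x y j : T) : Prop :=
  [/\ j \in A, le x j, le y j &
      forall z, z \in A -> le x z -> le y z -> le j z].

(* The subset A, with the order induced by le, is a lattice. *)
Definition is_lattice_in : Prop :=
  forall x y, x \in A -> y \in A ->
    (exists m, is_meet_in x y m) /\ (exists j, is_join_in x y j).

End Lattice.

(* The intervals themselves are collected, as subsets of 'S_n.  The condition
   v <= w is needed because [v, w] is only an interval in that case. *)
Definition lattice_intervals_from (n : nat) (v : 'S_n) : {set {set 'S_n}} :=
  [set I | `[< exists w : 'S_n,
      [/\ bruhat v w, I = bruhat_interval v w & is_lattice_in (@bruhat n) I] >]].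

(* Main.v *)
(* Write f(k, m) for the number of w in S_(k + m) with s_k <= w and [s_k, w] a
   lattice.  Below, Bruhat order is handled through the rank criterion: v <= w
   iff #{p < i : v p >= j} <= #{p < i : w p >= j} for all i and j.

   Let m >= 4, n = k + m and s = s_(n-1).  If u is in S_(n-1), then [s_k, u s] and
   [s_k, s u] are the products of [s_k, u] with a two-element chain, hence
   lattices whenever [s_k, u] is.  An element w >= s_k that has none of the forms
   u, u s and s u lies above s_k s_(n-2) s_(n-1) s_(n-2), so that [s_k, w] has
   an interval isomorphic to the Bruhat order of S_3, and is not a lattice.
   As u s = s u' forces u = u' to be in S_(n-2), inclusion-exclusion gives
   f(k, m) = 3 f(k, m - 1) - f(k, m - 2).

   Moreover f(k, m) = f(m, k) by conjugation with the longest element.  The values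
   f(1, 2) = 4, f(1, 3) = 12, f(2, 2) = 17, f(2, 3) = 51, f(3, 3) = 153 are
   computed; they yield f(1, m) = 4 F_(2m-2) and, for k, m >= 2, the value
   f(k, m) = 17 F_(2k-2) F_(2m-2), which is the stated one by the addition formula
   F_(a+b+1) = F_(a+1) F_(b+1) + F_a F_b. *)

Require Import Defs.
From mathcomp Require Import all_boot all_fingroup boolp.
From mathcomp Require Import zify.

Set Implicit Arguments.
Unset Strict Implicit.
Unset Printing Implicit Defensive.

(** * The rank criterion *)

Definition rk n (w : 'S_n) (i j : nat) : nat :=
  \sum_(p < n) ((p < i) && (j <= w p)).

Definition rle n (v w : 'S_n) : Prop := forall i j, rk v i j <= rk w i j.

Section Rank.

Variable n : nat.
Implicit Types (v w : 'S_n) (a b x : 'I_n).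

Lemma rk_0 w j : rk w 0 j = 0.
Proof. by rewrite /rk big1. Qed.

Lemma rk_out w i j : n <= j -> rk w i j = 0.
Proof.
move=> nj; rewrite /rk big1 // => p _.
by rewrite (leqNgt j) (leq_trans (ltn_ord _) nj) andbF.
Qed.

(** Raising the threshold past the value [x] drops only the place of [x]. Most rank computations
    below reduce to such differences. *)
Lemma rkSr w i x : rk w i x = rk w i x.+1 + (w^-1%g x < i).
Proof.
rewrite /rk (bigD1 (w^-1%g x)) //= [in RHS](bigD1 (w^-1%g x)) //=.
rewrite permKV leqnn ltnn andbT andbF add0n addnC; congr (_ + _).
apply: eq_bigr => p pN; congr (nat_of_bool (_ && _)).
rewrite [in LHS]leq_eqVlt; case: eqP => // /val_inj E.
by rewrite E permK eqxx in pN.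
Qed.

Lemma rkSl w x j : rk w x.+1 j = rk w x j + (j <= w x).
Proof.
rewrite /rk (bigD1 x) //= [in RHS](bigD1 x) //=.
rewrite ltnSn ltnn add0n addnC; congr (_ + _).
apply: eq_bigr => p pN; congr (nat_of_bool (_ && _)).
by rewrite ltnS leq_eqVlt; case: eqP => // /val_inj E; rewrite E eqxx in pN.
Qed.

Lemma rk_anti w i j j' : j <= j' -> rk w i j' <= rk w i j.
Proof.
move=> le_j; apply: leq_sum => p _; case: (p < i) => //=.
by case: (leqP j' (w p)) => // jw; rewrite (leq_trans le_j jw).
Qed.

Lemma rk_full w i j : n <= i -> rk w i j = n - j.
Proof.
move=> ni; rewrite /rk.
rewrite (eq_bigr (fun p => nat_of_bool (j <= w p))); last first.
  by move=> p _; rewrite (leq_trans (ltn_ord p) ni).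
rewrite -(@reindex_inj _ _ _ _ w xpredT (fun q : 'I_n => nat_of_bool (j <= q))) /=;
  last exact: perm_inj.
rewrite -(big_mkord xpredT (fun q => nat_of_bool (j <= q))) {ni i w}.
elim: n => [|m IH]; first by rewrite big_nil; lia.
by rewrite big_nat_recr //= IH; lia.
Qed.

Lemma rk_j0 w i : i <= n -> rk w i 0 = i.
Proof.
elim: i => [|i IH] lin; first by rewrite rk_0.
by rewrite (rkSl w (Ordinal lin)) /= IH 1?ltnW // addn1.
Qed.

(** Outside the [n] by [n] table the ranks are the same for all permutations. *)
Lemma rle_bounded v w :
  (forall i j, i < n -> j < n -> rk v i j <= rk w i j) -> rle v w.
Proof.
move=> H i j; case: (ltnP i n) => [lin|nli]; last by rewrite !rk_full.
by case: (ltnP j n) => [|nlj]; [apply: H | rewrite !rk_out].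
Qed.

Lemma rle_refl w : rle w w. Proof. by move=> i j. Qed.

Lemma rle_trans u v w : rle u v -> rle v w -> rle u w.
Proof. by move=> uv vw i j; apply: leq_trans (uv i j) (vw i j). Qed.

(** By [rkSr], equal ranks tell for each value the same set of [i] beyond its place, and so the same
    inverse permutation. *)
Lemma rle_anti v w : rle v w -> rle w v -> v = w.
Proof.
move=> vw wv; have E i j : rk v i j = rk w i j.
  by apply/eqP; rewrite eqn_leq vw wv.
apply/invg_inj/permP => x; apply/val_inj/eqP.
have H i : (v^-1%g x < i) = (w^-1%g x < i).
  by apply: (can_inj oddb); have := rkSr v i x; rewrite !E (rkSr w i x); lia.
by rewrite eqn_leq -ltnS H ltnSn /= -ltnS -H ltnSn.
Qed.

Lemma rk_id i j : i <= n -> rk (1%g : 'S_n) i j = i - j.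
Proof.
elim: i => [|i IH] lin; first by rewrite rk_0.
by rewrite (rkSl _ (Ordinal lin)) perm1 /= (IH (ltnW lin)); lia.
Qed.

(** At most [j] of the first [i] places can hold a value below [j]. The identity attains this bound,
    which makes it the least element. *)
Lemma rk_ge w i j : i <= n -> i - j <= rk w i j.
Proof.
elim: j => [|j IH] lin; first by rewrite rk_j0; lia.
case: (ltnP j n) => jn; last first.
  by rewrite (_ : i - j.+1 = 0) //; apply/eqP; rewrite subn_eq0 (leq_trans lin) // leqW.
by have := rkSr w i (Ordinal jn); move: (IH lin) => /=; lia.
Qed.

Lemma rle1 w : rle 1%g w.
Proof. by apply: rle_bounded => i j lin _; rewrite rk_id ?rk_ge // ltnW. Qed.

(** * Multiplication by an adjacent transposition *)

Section Adjacent.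

Variables a b : 'I_n.
Hypothesis ab : b = a.+1 :> nat.

Lemma tperm_leq j x : j != b :> nat -> (j <= tperm a b x) = (j <= x).
Proof. by move=> /eqP jb; case: tpermP => [->|->|] //; lia. Qed.

Lemma tperm_ltn j x : j != b :> nat -> (tperm a b x < j) = (x < j).
Proof. by move=> jb; rewrite !ltnNge tperm_leq. Qed.

(** The product exchanges the values [a] and [b], and only the threshold [b] separates them. Left
    multiplication exchanges places instead and so affects only the row [b]. *)
Lemma rk_mulr w i j : j != b :> nat -> rk (w * tperm a b) i j = rk w i j.
Proof. by move=> jb; apply: eq_bigr => p _; rewrite permM tperm_leq. Qed.

Lemma rk_mull w i j : i != b :> nat -> rk (tperm a b * w) i j = rk w i j.
Proof.
move=> ib; rewrite /rk (reindex_inj (@perm_inj _ (tperm a b))) /=.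
by apply: eq_bigr => p _; rewrite permM tpermK tperm_ltn.
Qed.

Lemma rk_mulr_eq w i :
  rk (w * tperm a b) i b = rk w i b.+1 + (w^-1%g a < i).
Proof. by rewrite rkSr rk_mulr ?invMg ?tpermV ?permM ?tpermR //; lia. Qed.

Lemma rk_mull_eq w j :
  rk (tperm a b * w) b j = rk w a j + (j <= w b).
Proof.
by rewrite {1}ab rkSl rk_mull ?permM ?tpermL //; lia.
Qed.

Lemma rk_ab w i : rk w i a = rk w i b + (w^-1%g a < i).
Proof. by rewrite rkSr ab. Qed.

Lemma rle_mulr_asc w : w^-1%g a < w^-1%g b -> rle w (w * tperm a b).
Proof.
move=> asc i j; case: (@eqP _ j b) => [->|/eqP jb]; last by rewrite rk_mulr.
by rewrite rk_mulr_eq rkSr; lia.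
Qed.

(** The lifting property of Bruhat order. Only the column [b] is in question; there it follows by
    comparing [v] and [w] in the columns [a], [b] and [b.+1], since the order of the places of [a]
    and [b] is known in both. *)
Lemma rle_lift v w :
    w^-1%g b < w^-1%g a -> v^-1%g a < v^-1%g b -> rle v w ->
  rle v (w * tperm a b).
Proof.
move=> dw av vw i j; case: (@eqP _ j b) => [->|/eqP jb]; last first.
  by rewrite rk_mulr.
have := vw i a; have := vw i b; have := vw i b.+1.
by rewrite rk_mulr_eq !rk_ab !(rkSr _ _ b); lia.
Qed.

Lemma rle_mulr2 v w :
    w^-1%g a < w^-1%g b -> rle v w -> rle (v * tperm a b) (w * tperm a b).
Proof.
move=> aw vw i j; case: (@eqP _ j b) => [->|/eqP jb]; last first.
  by rewrite !rk_mulr.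
have := vw i a; have := vw i b; have := vw i b.+1.
by rewrite !rk_mulr_eq !rk_ab !(rkSr _ _ b); lia.
Qed.

End Adjacent.

(** * Inversions and reduced words *)

(** The number of inversions: each value is charged with the larger values placed before it. *)
Definition ninv w := \sum_x rk w (w^-1%g x) x.+1.

(** Only the relative order of [a] and [b] changes. The additive form covers ascents and descents at
    once. *)
Lemma inv_mulr a b w : b = a.+1 :> nat ->
  ninv (w * tperm a b) + (w^-1%g b < w^-1%g a) = ninv w + (w^-1%g a < w^-1%g b).
Proof.
move=> ab; have aNb : b != a by apply/eqP => E; move: ab; rewrite E; lia.
rewrite /ninv (bigD1 a) // (bigD1 b) //= [in RHS](bigD1 a) // [in RHS](bigD1 b) //=.
rewrite !invMg tpermV !permM tpermL tpermR -ab.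
rewrite (rk_mulr_eq ab) (rk_mulr ab); last by lia.
rewrite (rkSr w (w^-1%g a) b).
rewrite [X in _ + _ + (_ + X)](eq_bigr (fun x => rk w (w^-1%g x) x.+1)).
  move: (\sum_(_ < n | _) _) (rk _ _ _) (rk _ _ _) (_ < _) (_ < _) => *; lia.
move=> x /andP[xa xb]; rewrite permM tpermD 1?eq_sym // (rk_mulr ab) // ab eqSS.
by apply: contra xa => /eqP/val_inj->.
Qed.

(** Without descents [w^-1] is increasing, so that [x <= w^-1 x] for all [x]. Both sides have the
    same sum, which forces equality everywhere. *)
Lemma perm_desc w : w != 1%g -> exists a b, b = a.+1 :> nat /\ w^-1%g b < w^-1%g a.
Proof.
move=> wN; apply: contrapT => nodesc.
have asc a b : b = a.+1 :> nat -> w^-1%g a < w^-1%g b.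
  move=> ab; rewrite ltn_neqAle; apply/andP; split; last first.
    by rewrite leqNgt; apply/negP => d; apply: nodesc; exists a, b.
  by apply/eqP => /val_inj/perm_inj E; move: ab; rewrite E; lia.
have ge x : x <= w^-1%g x.
  case: x => x; elim: x => [//|x IH] ltx.
  by apply: leq_ltn_trans (IH (ltnW ltx)) (asc (Ordinal (ltnW ltx)) _ _).
have /leqif_sum [_] : forall x, true -> (x : nat) <= w^-1%g x ?= iff ((x : nat) == w^-1%g x).
  by move=> x _; split.
rewrite [X in _ == X](_ : _ = \sum_(x < n) x) ?eqxx; last first.
  by rewrite [RHS](reindex_inj (@perm_inj _ w^-1%g)).
move=> /esym/forallP H; case/eqP: wN; apply/invg_inj/permP => x.
by rewrite invg1 perm1; apply/val_inj/esym/eqP/H.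
Qed.

Lemma sigma_tperm i (hi : i.+1 < n) :
  sigma n i.+1 = tperm (Ordinal (ltnW hi)) (Ordinal hi).
Proof.
by rewrite /sigma /= (insubT (fun m => m < n) (ltnW hi)) (insubT (fun m => m < n) hi).
Qed.

Lemma sigma_adj a b : b = a.+1 :> nat -> sigma n b = tperm a b.
Proof.
move=> ab; have hb : a.+1 < n by rewrite -ab.
by rewrite ab (sigma_tperm hb); congr tperm; apply: val_inj.
Qed.

Lemma sigmaP i : 0 < i < n ->
  exists a b, [/\ b = a.+1 :> nat, b = i :> nat & sigma n i = tperm a b].
Proof.
case: i => // i hi; exists (Ordinal (ltnW hi)), (Ordinal hi).
by rewrite sigma_tperm.
Qed.

Lemma word_prod_rcons s i : word_prod n (rcons s i) = (word_prod n s * sigma n i)%g.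
Proof. by rewrite /word_prod -cats1 big_cat big_seq1. Qed.

Lemma is_word_rcons s i : is_word n (rcons s i) = (0 < i < n) && is_word n s.
Proof. by rewrite /is_word all_rcons. Qed.

Lemma inv_word s : is_word n s -> ninv (word_prod n s) <= size s.
Proof.
elim/last_ind: s => [|s i IH].
  rewrite /word_prod big_nil /ninv big1 // => x _.
  by rewrite invg1 perm1 rk_id ?subnSn //; have := ltn_ord x; lia.
rewrite is_word_rcons word_prod_rcons size_rcons => /andP[hi /IH].
have [a [b [ab _ ->]]] := sigmaP hi.
by have := inv_mulr (word_prod n s) ab; lia.
Qed.

Lemma inv_desc a b w : b = a.+1 :> nat -> w^-1%g b < w^-1%g a ->
  ninv w = (ninv (w * tperm a b)).+1.
Proof. by move=> ab d; have := inv_mulr w ab; lia. Qed.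

Lemma word_mulr a b w s : b = a.+1 :> nat ->
    is_word n s -> word_prod n s = (w * tperm a b)%g ->
  is_word n (rcons s b) /\ word_prod n (rcons s b) = w.
Proof.
move=> ab ws ps; rewrite is_word_rcons word_prod_rcons ps (sigma_adj ab).
by rewrite -mulgA tperm2 mulg1 ws ltn_ord ab.
Qed.

Lemma inv_word_ex w : exists s, [/\ is_word n s, word_prod n s = w & size s = ninv w].
Proof.
have [m] := ubnP (ninv w); elim: m w => // m IH w.
case: (eqVneq w 1%g) => [-> _|/perm_desc [a [b [ab d]]]].
  exists [::]; split=> //; first by rewrite /word_prod big_nil.
  have := @inv_word [::] isT; rewrite /word_prod big_nil /=; lia.
rewrite (inv_desc ab d) => lt; have [//|s [ws ps ss]] := IH (w * tperm a b)%g.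
have [ws' ps'] := word_mulr ab ws ps.
by exists (rcons s b); split=> //; rewrite size_rcons ss.
Qed.

(** Each letter changes [ninv] by one, and removing descents one by one reaches the identity in
    exactly [ninv w] steps. So [ninv] is the Coxeter length. *)
Lemma reducedP s w :
  reduced_decomposition s w <->
  [/\ is_word n s, word_prod n s = w & size s = ninv w].
Proof.
split=> [[[ws ps] min]|[ws ps ss]].
  split=> //; have [t [wt pt st]] := inv_word_ex w.
  by apply/eqP; rewrite eqn_leq -{2}ps inv_word // -st min.
by split=> // t [wt pt]; rewrite ss -pt inv_word.
Qed.

End Rank.

(** * Bruhat order and lattices *)

Lemma subseq_rcons2 (T : eqType) (s t : seq T) x y :
  subseq (rcons s x) (rcons t y) =
    if x == y then subseq s t else subseq (rcons s x) t.
Proof.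
rewrite -subseq_rev !rev_rcons /= eq_sym; case: eqP => _; first exact: subseq_rev.
by rewrite -rev_rcons subseq_rev.
Qed.

(** Induction on the last letter of [t], which is an ascent of the product of the remaining word
    because [t] is reduced. If [s] does not use this letter, the product only grows; if it does, the
    letter is cancelled on both sides. *)
Lemma bruhat_rle n (v w : 'S_n) : bruhat v w -> rle v w.
Proof.
case=> [s [t [/reducedP[ws ps ss] /reducedP[wt pt st]]]].
elim/last_ind: t s v w ws ps ss wt pt st => [|t i IH] s v w ws ps ss wt pt st.
  by move=> /eqP s0; move: ps; rewrite -{}pt s0 => ->; apply: rle_refl.
move: wt pt st; rewrite is_word_rcons word_prod_rcons size_rcons.
move=> /andP[hi wt]; have [a [b [ab bi si]]] := sigmaP hi; rewrite si => pt st.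
have := inv_mulr (word_prod n t) ab; rewrite pt => I.
have it := inv_word wt.
have asc : (word_prod n t)^-1%g a < (word_prod n t)^-1%g b by lia.
have st' : size t = ninv (word_prod n t) by lia.
rewrite -pt; case/lastP: s ws ps ss => [|s j] ws ps ss.
  by move=> _; rewrite -ps /word_prod big_nil; apply: rle1.
rewrite subseq_rcons2; case: eqP => [ji|_] sub; last first.
  apply: rle_trans (rle_mulr_asc ab asc).
  exact: (IH _ _ _ ws ps ss wt erefl st' sub).
move: ws ps ss; rewrite is_word_rcons word_prod_rcons size_rcons ji si.
move=> /andP[_ ws] ps ss.
rewrite -ps; apply: rle_mulr2 => //.
apply: (IH s _ _ ws erefl _ wt erefl st' sub).
by have := inv_mulr (word_prod n s) ab; have := inv_word ws; rewrite ps; lia.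
Qed.

(** Induction on the length of [w]: a descent of [w] is stripped off, and the lifting property keeps
    [v], or [v] with the same descent stripped off, below the rest. *)
Lemma rle_bruhat n (v w : 'S_n) : rle v w -> bruhat v w.
Proof.
have [m] := ubnP (ninv w); elim: m v w => // m IH v w lt vw.
case: (eqVneq w 1%g) => [w1|/perm_desc [a [b [ab d]]]].
  have -> : v = w by apply: rle_anti => //; rewrite w1; apply: rle1.
  have [s rs] := inv_word_ex w.
  by exists s, s; split=> //; apply/reducedP.
rewrite (inv_desc ab d) in lt.
have extend t : reduced_decomposition t (w * tperm a b)%g ->
    reduced_decomposition (rcons t b) w.
  move=> /reducedP[wt pt st]; apply/reducedP.
  have [wt' pt'] := word_mulr ab wt pt.
  by split=> //; rewrite size_rcons st (inv_desc ab d).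
case: (ltnP (v^-1%g a) (v^-1%g b)) => [asc|].
  have [//|s [t [rs rt st]]] := IH v (w * tperm a b)%g _ (rle_lift ab d asc vw).
  by exists s, (rcons t b); split; [|exact: extend|apply: subseq_trans (subseq_rcons _ _)].
rewrite leq_eqVlt => /orP[/eqP/val_inj/perm_inj E|d'].
  by move: ab; rewrite E; lia.
have asc : (v * tperm a b)^-1%g a < (v * tperm a b)^-1%g b.
  by rewrite invMg tpermV !permM tpermL tpermR.
have vv : rle (v * tperm a b)%g v.
  by have := rle_mulr_asc ab asc; rewrite -mulgA tperm2 mulg1.
have [//|s [t [rs rt st]]] :=
  IH _ (w * tperm a b)%g _ (rle_lift ab d asc (rle_trans vv vw)).
exists (rcons s b), (rcons t b); split; [|exact: extend|by rewrite subseq_rcons2 eqxx].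
move: rs => /reducedP[ws ps ss]; apply/reducedP.
have [ws' ps'] := word_mulr ab ws ps.
by split=> //; rewrite size_rcons ss (inv_desc ab d').
Qed.

Lemma bruhatE n : @bruhat n = @rle n.
Proof.
by apply/funext => v; apply/funext => w; apply/propext; split;
  [apply: bruhat_rle | apply: rle_bruhat].
Qed.

(** * Constructions that preserve lattices *)

Section LatticeTransfer.

Variables (T T' : finType) (le : T -> T -> Prop) (le' : T' -> T' -> Prop).

Lemma is_lattice_iso (A : {set T}) (f : T -> T') :
    {in A &, forall x y, le' (f x) (f y) <-> le x y} ->
  is_lattice_in le' (f @: A) <-> is_lattice_in le A.
Proof.
move=> fle; split=> L x y xA yA.
  have [[m [/imsetP[m0 m0A ->] mx my mz]] [j [/imsetP[j0 j0A ->] jx jy jz]]] :=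
    L _ _ (imset_f f xA) (imset_f f yA).
  split; [exists m0|exists j0]; split=> //; try exact/fle.
    by move=> z zA zx zy; apply/(fle _ _ zA m0A)/mz; [apply: imset_f|exact/fle|exact/fle].
  by move=> z zA zx zy; apply/(fle _ _ j0A zA)/jz; [apply: imset_f|exact/fle|exact/fle].
case/imsetP: xA => x0 x0A ->; case/imsetP: yA => y0 y0A ->.
have [[m [mA mx my mz]] [j [jA jx jy jz]]] := L _ _ x0A y0A.
split; [exists (f m)|exists (f j)]; split; try exact: imset_f; try exact/fle.
  move=> _ /imsetP[z zA ->] /fle zx /fle zy; apply/fle => //.
  by apply: mz => //; [exact: zx|exact: zy].
move=> _ /imsetP[z zA ->] /fle zx /fle zy; apply/fle => //.
by apply: jz => //; [exact: zx|exact: zy].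
Qed.

(** In the product with the chain [bool], meets and joins are taken componentwise. *)
Lemma is_lattice_prod (A : {set T}) (f : T -> bool -> T') :
    (forall x y a b, x \in A -> y \in A -> le' (f x a) (f y b) <-> le x y /\ (a ==> b)) ->
  is_lattice_in le A -> is_lattice_in le' [set f x a | x in A, a in predT].
Proof.
move=> fle L _ _ /imset2P[x a xA _ ->] /imset2P[y b yA _ ->].
have [[m [mA mx my mz]] [j [jA jx jy jz]]] := L _ _ xA yA.
split; [exists (f m (a && b))|exists (f j (a || b))].
  split; first exact: imset2_f.
  - by apply/fle => //; split=> //; case: (a); case: (b).
  - by apply/fle => //; split=> //; case: (a); case: (b).
  move=> _ /imset2P[z c zA _ ->] /fle[//|//|zx ca] /fle[//|//|zy cb].
  by apply/fle => //; split; [apply: mz|case: (c) ca cb => //= -> ->].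
split; first exact: imset2_f.
- by apply/fle => //; split=> //; case: (a); case: (b).
- by apply/fle => //; split=> //; case: (a); case: (b).
move=> _ /imset2P[z c zA _ ->] /fle[//|//|zx ac] /fle[//|//|zy bc].
by apply/fle => //; split; [apply: jz|case: (a) (b) ac bc => [] []].
Qed.

(** The meet and join in [A] of two elements below [u] are again below [u]. *)
Lemma is_lattice_sub (A B : {set T}) u :
    (forall x y z, le x y -> le y z -> le x z) ->
    B \subset A -> (forall x, x \in B = (x \in A) && `[< le x u >]) -> le u u ->
    u \in A -> is_lattice_in le A -> is_lattice_in le B.
Proof.
move=> tr BA BE uu uA L x y xB yB.
have [xA yA] := (subsetP BA _ xB, subsetP BA _ yB).
have lB z : z \in B -> le z u by rewrite BE => /andP[_ /asboolP].
have [[m [mA mx my mz]] [j [jA jx jy jz]]] := L _ _ xA yA.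
split; [exists m|exists j].
  split=> // [|z /(subsetP BA)]; last exact: mz.
  by rewrite BE mA; apply/asboolP/(tr _ _ _ mx)/lB.
split=> // [|z /(subsetP BA)]; last exact: jz.
by rewrite BE jA; apply/asboolP/jz => //; apply: lB.
Qed.

(** The join is the infimum of all common upper bounds. Finite infima are built from binary meets,
    the top [u] being the infimum of the empty list. *)
Lemma meets_is_lattice (A : {set T}) u :
    (forall x y z, le x y -> le y z -> le x z) ->
    u \in A -> {in A, forall x, le x u} ->
    {in A &, forall x y, exists m, is_meet_in le A x y m} ->
  is_lattice_in le A.
Proof.
move=> tr uA u_top meet x y xA yA; split; first exact: meet.
have inf (s : seq T) : {subset s <= A} -> exists j, [/\ j \in A, {in s, forall z, le j z}
    & {in A, forall z, {in s, forall t, le z t} -> le z j}].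
  elim: s => [_|t s IH sA]; first by exists u; split=> // z /u_top.
  have [i [iA is_ i_inf]] : exists j, [/\ j \in A, {in s, forall z, le j z}
    & {in A, forall z, {in s, forall t, le z t} -> le z j}].
    by apply: IH => z zs; apply: sA; rewrite inE zs orbT.
  have [m [mA mt mi m_inf]] := meet t i (sA t (mem_head t s)) iA.
  exists m; split=> // [z|z zA zs].
    by rewrite inE => /predU1P[->//|/is_]; apply: tr.
  apply: m_inf => //; first exact/zs/mem_head.
  by apply: i_inf => // r rs; apply: zs; rewrite inE rs orbT.
have [|j [jA js j_inf]] := inf (enum [set z in A | `[< le x z /\ le y z >]]).
  by move=> z; rewrite mem_enum inE; case/andP.
exists j; split=> //.
- by apply: j_inf => // z; rewrite mem_enum inE => /andP[_ /asboolP[]].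
- by apply: j_inf => // z; rewrite mem_enum inE => /andP[_ /asboolP[]].
by move=> z zA xz yz; apply: js; rewrite mem_enum inE zA; apply/asboolP.
Qed.

End LatticeTransfer.

(** * Intervals above a generator *)

(** Being above [sigma n k] is encoded by a single positive rank; [rle_sigma] justifies this. *)
Definition atom_interval n k (w : 'S_n) : {set 'S_n} :=
  [set u | (0 < rk u k k) && `[< rle u w >]].

Definition atom_lattices n k : {set 'S_n} :=
  [set w | (0 < rk w k k) && `[< is_lattice_in (@rle n) (atom_interval k w) >]].

Lemma atom_intervalP n k (u w : 'S_n) :
  reflect (0 < rk u k k /\ rle u w) (u \in atom_interval k w).
Proof. by rewrite inE; apply: (iffP andP) => -[-> /asboolP]. Qed.

Lemma atom_latticesP n k (w : 'S_n) :
  reflect (0 < rk w k k /\ is_lattice_in (@rle n) (atom_interval k w))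
    (w \in atom_lattices n k).
Proof. by rewrite inE; apply: (iffP andP) => -[-> /asboolP]. Qed.

Lemma atom_interval_top n k (w : 'S_n) : 0 < rk w k k -> w \in atom_interval k w.
Proof. by move=> wk; apply/atom_intervalP; split=> //; apply: rle_refl. Qed.

Lemma rk_sigma n k i j : 0 < k < n -> i <= n ->
  rk (sigma n k) i j = i - j + ((i == k) && (j == k)).
Proof.
move=> kn lin; have [a [b [ab bk ->]]] := sigmaP kn; rewrite -[tperm a b]mul1g.
case: (@eqP _ j k) => [->|/eqP jk]; last by rewrite (rk_mulr ab) ?bk // rk_id // andbF addn0.
by rewrite -bk (rk_mulr_eq ab) rk_id // invg1 perm1; lia.
Qed.

(** The ranks of the generator exceed the minimal ones of the identity only at the entry [(k, k)],
    and there by one. *)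
Lemma rle_sigma n k (w : 'S_n) : 0 < k < n -> rle (sigma n k) w <-> 0 < rk w k k.
Proof.
move=> kn; split=> [/(_ k k)|wk].
  by rewrite rk_sigma ?eqxx //=; lia.
apply: rle_bounded => i j lin jn; rewrite rk_sigma ?(ltnW lin) //.
case: (altP andP) => [[/eqP-> /eqP->]|_]; first by rewrite subnn.
by rewrite addn0 rk_ge // ltnW.
Qed.

(** An interval determines its top, so the intervals may be counted by their tops. *)
Lemma card_lattice_intervals n k : 0 < k < n ->
  #|lattice_intervals_from (sigma n k)| = #|atom_lattices n k|.
Proof.
move=> kn.
have IE (w : 'S_n) : bruhat_interval (sigma n k) w = atom_interval k w.
  apply/setP => u; rewrite inE bruhatE; apply/asboolP/atom_intervalP.
    by case=> /(rle_sigma _ kn).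
  by case=> uk uw; split=> //; apply/(rle_sigma _ kn).
rewrite (_ : lattice_intervals_from _ = (@atom_interval n k) @: atom_lattices n k).
  rewrite card_in_imset // => v w /atom_latticesP[vk _] /atom_latticesP[wk _] E.
  have := atom_interval_top vk; rewrite E => /atom_intervalP[_ vw].
  have := atom_interval_top wk; rewrite -E => /atom_intervalP[_ wv].
  exact: rle_anti.
apply/setP => I; rewrite inE bruhatE; apply/asboolP/imsetP.
  case=> w [/(rle_sigma _ kn) wk IEw L]; exists w; rewrite ?IE in IEw *; last by [].
  by apply/atom_latticesP; rewrite -IEw.
case=> w /atom_latticesP[wk L] ->; exists w; split; rewrite ?IE //.
exact/(rle_sigma _ kn).
Qed.

Lemma atom_lattices_down n k (u w : 'S_n) :
    w \in atom_lattices n k -> 0 < rk u k k -> rle u w ->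
  u \in atom_lattices n k.
Proof.
move=> /atom_latticesP[wk L] uk uw; apply/atom_latticesP; split=> //.
apply: is_lattice_sub (@rle_refl n u) _ L.
- exact: rle_trans.
- apply/subsetP => x /atom_intervalP[xk xu]; apply/atom_intervalP.
  by split=> //; apply: rle_trans uw.
- move=> x; apply/atom_intervalP/andP => -[].
    by move=> xk xu; split; [apply/atom_intervalP; split=> //; apply: rle_trans uw|apply/asboolP].
  by move=> /atom_intervalP[xk _] /asboolP.
by apply/atom_intervalP.
Qed.

(** * Conjugation by the longest element *)

Section Flip.

Variable n : nat.
Implicit Types w : 'S_n.

Definition rev_perm : 'S_n := perm (@rev_ord_inj n).

Definition flip w : 'S_n := (rev_perm * w * rev_perm)%g.

Lemma flipE w x : flip w x = rev_ord (w (rev_ord x)).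
Proof. by rewrite !permM !permE. Qed.

Lemma flipK : involutive flip.
Proof. by move=> w; apply/permP => x; rewrite !flipE !rev_ordK. Qed.

(** Reversal of places and values turns the counted quadrant into the opposite one; the two counts
    are related by inclusion-exclusion, written here without subtracting ranks. *)
Lemma rk_flip w i j : i <= n -> j <= n ->
  rk (flip w) i j + (n - i) = n - j + rk w (n - i) (n - j).
Proof.
move=> lin ljn; elim: i lin => [|i IH] lin.
  by rewrite rk_0 subn0 rk_full //; lia.
rewrite (rkSl _ (Ordinal lin)) flipE.
have := rkSl w (rev_ord (Ordinal lin)) (n - j); move: (IH (ltnW lin)) => /=.
have lt := ltn_ord (w (rev_ord (Ordinal lin))).
rewrite (_ : (n - i.+1).+1 = n - i); last by lia.
by move: (rk _ _ _) (rk _ _ _) (rk _ _ _) lt => *; lia.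
Qed.

Lemma rle_flip v w : rle v w -> rle (flip v) (flip w).
Proof.
move=> vw; apply: rle_bounded => i j lin ljn.
have := vw (n - i) (n - j).
have := rk_flip v (ltnW lin) (ltnW ljn).
by have := rk_flip w (ltnW lin) (ltnW ljn); lia.
Qed.

Lemma rle_flipE v w : rle (flip v) (flip w) <-> rle v w.
Proof. by split=> /rle_flip; rewrite ?flipK. Qed.

Lemma rk_flip_atom w k : k <= n -> rk (flip w) (n - k) (n - k) = rk w k k.
Proof. by move=> kn; have := @rk_flip w (n - k) (n - k); rewrite !subKn //; lia. Qed.

Lemma flip_atom_interval k w : k <= n ->
  atom_interval (n - k) (flip w) = flip @: atom_interval k w.
Proof.
move=> kn; apply/setP => x; rewrite -[x]flipK mem_imset; last exact: can_inj flipK.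
apply/atom_intervalP/atom_intervalP; rewrite rk_flip_atom // => -[? ?]; split=> //.
  exact/rle_flipE.
exact/rle_flipE.
Qed.

Lemma flip_atom_lattices k w : k <= n ->
  w \in atom_lattices n k -> flip w \in atom_lattices n (n - k).
Proof.
move=> kn /atom_latticesP[wk L]; apply/atom_latticesP.
rewrite rk_flip_atom // flip_atom_interval //; split=> //.
by apply/(is_lattice_iso (le := @rle n)) => // x y _ _; apply: rle_flipE.
Qed.

Lemma card_atom_lattices_sym k : k <= n ->
  #|atom_lattices n (n - k)| = #|atom_lattices n k|.
Proof.
have le h : h <= n -> #|atom_lattices n h| <= #|atom_lattices n (n - h)|.
  move=> hn; rewrite -(card_imset _ (can_inj flipK)); apply/subset_leq_card/subsetP.
  by move=> _ /imsetP[w wL ->]; apply: flip_atom_lattices.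
by move=> kn; apply/eqP; rewrite eqn_leq le // -{2}(subKn kn) le ?leq_subr.
Qed.

End Flip.

(** * The recurrence *)

Section Embedding.

Variable n : nat.
Implicit Types (u v : 'S_n) (x : 'S_n.+1).

Definition emb u : 'S_n.+1 := lift_perm ord_max ord_max u.

Lemma emb_max u : emb u ord_max = ord_max.
Proof. exact: lift_perm_id. Qed.

Lemma emb_inj : injective emb.
Proof.
move=> u v E; apply/permP => p; apply: (@lift_inj _ ord_max).
by rewrite -!(lift_perm_lift ord_max) -/(emb u) E.
Qed.

Lemma emb_onto x : x ord_max = ord_max -> exists u, x = emb u.
Proof.
move=> xm.
(* The default is never taken, since only the last point is sent to the last point. *)
pose f p := odflt p (unlift ord_max (x (lift ord_max p))).
have fE p : lift ord_max (f p) = x (lift ord_max p).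
  rewrite /f; case: unliftP => //= E; case/eqP: (neq_lift (@ord_max n) p).
  by apply: (@perm_inj _ x); rewrite xm E.
have f_inj : injective f.
  move=> p q E; apply: (@lift_inj _ ord_max); apply: (@perm_inj _ x).
  by rewrite -!fE E.
exists (perm f_inj); apply/permP => p; case: (unliftP ord_max p) => [q|] ->.
  by rewrite lift_perm_lift permE fE.
by rewrite emb_max.
Qed.

Lemma rk_emb u i j : rk (emb u) i j = rk u i j + ((n < i) && (j <= n)).
Proof.
rewrite /rk big_ord_recr /= emb_max; congr (_ + _); apply: eq_bigr => p _.
have -> : widen_ord (leqnSn n) p = lift ord_max p.
  by apply: val_inj; rewrite /= /bump leqNgt ltn_ord.
by rewrite lift_perm_lift /= /bump (leqNgt n (u p)) ltn_ord.
Qed.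

End Embedding.

(** * Multiplication by the last generator *)

Section Peel.

Variable m : nat.
Implicit Types (u v : 'S_m.+1) (x w : 'S_m.+2) (y : bool).

Definition penult : 'I_m.+2 := Ordinal (leqnSn m.+1).

Local Notation A := penult.
Local Notation B := (@ord_max m.+1).

Definition last_adj : 'S_m.+2 := tperm A B.

Local Notation s := last_adj.

Let AB : B = A.+1 :> nat. Proof. by []. Qed.

(** The flag [y] is the coordinate in the two-element chain: it tells whether the last generator is
    present. *)
Definition peelr u y : 'S_m.+2 := if y then (emb u * s)%g else emb u.
Definition peell u y : 'S_m.+2 := if y then (s * emb u)%g else emb u.

Lemma rk_penult u : rk u m.+1 m = 1.
Proof. by rewrite rk_full // subSnn. Qed.

Lemma rk_peelr u y i j : i <= m.+1 ->
  rk (peelr u y) i j = if j == m.+1 then y * rk u i m else rk u i j.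
Proof.
move=> lim; have E k : rk (emb u) i k = rk u i k by rewrite rk_emb ltnNge lim addn0.
case: y => /=; last by rewrite E; case: eqP => // ->; rewrite rk_out.
case: (@eqP _ j m.+1) => [->|/eqP jm]; last by rewrite (rk_mulr AB).
rewrite (rk_mulr_eq AB _ i) E rk_out // add0n mul1n -E.
by rewrite (rkSr (emb u) i A) E rk_out.
Qed.

Lemma rk_peell u y i j : j <= m.+1 ->
  rk (peell u y) i j =
    if i == m.+1 then (if y then (rk u m j).+1 else m.+1 - j)
    else rk u i j + (m.+1 < i).
Proof.
move=> ljm; case: y => /=; last first.
  by rewrite rk_emb ljm andbT; case: eqP => // ->; rewrite rk_full // ltnn addn0.
case: (@eqP _ i m.+1) => [->|/eqP im]; last by rewrite (rk_mull AB) // rk_emb ljm andbT.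
rewrite (rk_mull_eq AB _ j) emb_max /= ljm rk_emb (_ : m.+1 < m = false) ?addn0 ?addn1 //.
by lia.
Qed.

(** The flag can be read off from the table, as the entry at [(m.+1, m.+1)]; the entries with
    smaller indices are those of [u]. *)
Lemma rle_peelr u v y z : rle (peelr u y) (peelr v z) <-> rle u v /\ (y ==> z).
Proof.
split=> [uv|[uv yz]].
  split.
    apply: rle_bounded => i j lim ljm; have := uv i j.
    by rewrite !rk_peelr ?(ltnW lim) // ltn_eqF.
  by have := uv m.+1 m.+1; rewrite !rk_peelr // eqxx !rk_penult; case: (y) (z) => [] [].
apply: rle_bounded => i j lim ljm; rewrite !rk_peelr //.
by case: eqP => _; [case: (y) (z) yz => [] [] //= _; rewrite !mul1n|].
Qed.

Lemma rle_peell u v y z : rle (peell u y) (peell v z) <-> rle u v /\ (y ==> z).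
Proof.
split=> [uv|[uv yz]].
  split.
    apply: rle_bounded => i j lim ljm; have := uv i j.
    by rewrite !rk_peell ?(ltnW ljm) // ltn_eqF // ltnNge (ltnW lim) !addn0.
  have := uv m.+1 m.+1; rewrite !rk_peell // eqxx !(@rk_out _ _ m m.+1) // subnn.
  by case: (y) (z) => [] [].
apply: rle_bounded => i j lim ljm; rewrite !rk_peell //.
case: eqP => _; last by rewrite leq_add2r.
(* The lower bound on the ranks of [v] serves the case where [y] is false and [z] is true. *)
have := uv m j; have := rk_ge v j (leqnSn m).
by case: (y) (z) yz => [] [] //= _; lia.
Qed.

Lemma rk_peelr_low u y k : k <= m -> rk (peelr u y) k k = rk u k k.
Proof. by move=> km; rewrite rk_peelr; [rewrite ltn_eqF|apply: leqW]. Qed.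

Lemma rk_peell_low u y k : k <= m -> rk (peell u y) k k = rk u k k.
Proof.
by move=> km; rewrite rk_peell; [rewrite ltn_eqF // ltnNge ltnW ?addn0 //|apply: leqW].
Qed.

(** If the last place holds the last value, [x] is embedded; if it holds the last but one,
    multiplying by [s] makes it so. *)
Lemma peelr_onto x : A <= x B -> exists u y, x = peelr u y.
Proof.
rewrite leq_eqVlt => /orP[/eqP/val_inj xA|lt].
  have [|u xu] := @emb_onto _ (x * s)%g; first by rewrite permM -xA tpermL.
  by exists u, true; rewrite /= -xu -mulgA tperm2 mulg1.
have [|u xu] := @emb_onto _ x; last by exists u, false.
by apply: val_inj => /=; have := ltn_ord (x B); move: lt => /=; lia.
Qed.

Lemma peell_onto x : A <= x^-1%g B -> exists u y, x = peell u y.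
Proof.
rewrite leq_eqVlt => /orP[/eqP/val_inj xA|lt].
  have [|u xu] := @emb_onto _ (s * x)%g; first by rewrite permM tpermR xA permKV.
  by exists u, true; rewrite /= -xu mulgA tperm2 mul1g.
have [|u xu] := @emb_onto _ x; last by exists u, false.
apply: (@perm_inj _ x^-1%g); rewrite permK; apply: val_inj => /=.
by have := ltn_ord (x^-1%g B); move: lt => /=; lia.
Qed.

(** The elements [peelr u y] form a down-set: below one of them, at most one of the two largest
    values lies among the first [m.+1] places, so the other is in the last place. *)
Lemma rle_peelr_inv x u y : rle x (peelr u y) ->
  exists v z, [/\ x = peelr v z, rle v u & z ==> y].
Proof.
move=> xu; have [|v [z xv]] := @peelr_onto x.
  have := rkSl x B m; rewrite rk_full //.
  have := xu m.+1 m; rewrite rk_peelr // ltn_eqF // rk_penult /=.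
  by move: (rk _ _ _) => r *; lia.
by move: xu; rewrite xv => /rle_peelr[vu zy]; exists v, z.
Qed.

Lemma rle_peell_inv x u y : rle x (peell u y) ->
  exists v z, [/\ x = peell v z, rle v u & z ==> y].
Proof.
move=> xu; have [|v [z xv]] := @peell_onto x.
  have := rkSr x m B; rewrite (@rk_out _ _ m m.+2) // add0n.
  have := xu m m.+1; rewrite rk_peell // ltn_eqF // (@rk_out _ u) //=.
  by move: (rk _ _ _) => r *; lia.
by move: xu; rewrite xv => /rle_peell[vu zy]; exists v, z.
Qed.

Lemma atom_interval_emb k u : k <= m ->
  atom_interval k (emb u) = @emb m.+1 @: atom_interval k u.
Proof.
move=> km; apply/setP => x; apply/atom_intervalP/imsetP.
  (* Here [emb u] is read as [peelr u false]. *)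
  case=> xk /(@rle_peelr_inv x u false)[v [z [xv vu]]].
  rewrite implybF => z0; rewrite xv (negbTE z0) in xk *.
  by exists v => //; apply/atom_intervalP; rewrite (rk_peelr_low v false km) in xk.
case=> v /atom_intervalP[vk vu] ->; split.
  by rewrite (rk_peelr_low v false km).
by apply/(rle_peelr v u false false).
Qed.

Lemma emb_atom_lattices k u : k <= m ->
  (emb u \in atom_lattices m.+2 k) = (u \in atom_lattices m.+1 k).
Proof.
move=> km; rewrite [LHS]inE [RHS]inE (rk_peelr_low u false km); congr (_ && _).
apply: asbool_equiv_eq; rewrite atom_interval_emb //.
apply: is_lattice_iso => v w _ _.
by split=> [/(rle_peelr v w false false)[]//|vw]; apply/(rle_peelr v w false false).
Qed.

Lemma atom_interval_peelr k u : k <= m ->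
  atom_interval k (emb u * s) = [set peelr v z | v in atom_interval k u, z in predT].
Proof.
move=> km; apply/setP => x; apply/atom_intervalP/imset2P.
  case=> xk /(@rle_peelr_inv x u true)[v [z [xv vu _]]].
  rewrite xv rk_peelr_low // in xk; exists v z => //.
  exact/atom_intervalP.
case=> v z /atom_intervalP[vk vu] _ ->; rewrite rk_peelr_low //; split=> //.
by apply/(rle_peelr v u z true); rewrite implybT.
Qed.

Lemma atom_interval_peell k u : k <= m ->
  atom_interval k (s * emb u) = [set peell v z | v in atom_interval k u, z in predT].
Proof.
move=> km; apply/setP => x; apply/atom_intervalP/imset2P.
  case=> xk /(@rle_peell_inv x u true)[v [z [xv vu _]]].
  rewrite xv rk_peell_low // in xk; exists v z => //.
  exact/atom_intervalP.
case=> v z /atom_intervalP[vk vu] _ ->; rewrite rk_peell_low //; split=> //.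
by apply/(rle_peell v u z true); rewrite implybT.
Qed.

(** One direction is the product with a chain; the other holds because [emb u] lies below
    [emb u * s]. *)
Lemma peelr_atom_lattices k u : k <= m ->
  (emb u * s \in atom_lattices m.+2 k)%g = (u \in atom_lattices m.+1 k).
Proof.
move=> km; apply/idP/idP => [L|/atom_latticesP[uk L]].
  rewrite -emb_atom_lattices //; apply: (atom_lattices_down L).
    by case/atom_latticesP: L; rewrite (rk_peelr_low u true km) (rk_peelr_low u false km).
  by apply/(rle_peelr u u false true); split.
apply/atom_latticesP; rewrite (rk_peelr_low u true km) atom_interval_peelr //.
by split=> //; apply: is_lattice_prod L => *; apply: rle_peelr.
Qed.

Lemma peell_atom_lattices k u : k <= m ->
  (s * emb u \in atom_lattices m.+2 k)%g = (u \in atom_lattices m.+1 k).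
Proof.
move=> km; apply/idP/idP => [L|/atom_latticesP[uk L]].
  rewrite -emb_atom_lattices //; apply: (atom_lattices_down L).
    by case/atom_latticesP: L; rewrite (rk_peell_low u true km) (rk_peell_low u false km).
  by apply/(rle_peell u u false true); split.
apply/atom_latticesP; rewrite (rk_peell_low u true km) atom_interval_peell //.
by split=> //; apply: is_lattice_prod L => *; apply: rle_peell.
Qed.

(** Two elements of the interval have two common upper bounds in it between which no join fits. *)
Lemma not_lattice_far k w : 0 < k -> k.+2 <= m ->
  w B < m -> w^-1%g B < m -> w \notin atom_lattices m.+2 k.
Proof.
move=> k0 km wB wBV; apply/negP => /atom_latticesP[wk L].
have kn : 0 < k < m.+2 by lia.
have m0 : m.-1 < m.+2 by lia.
pose C : 'I_m.+2 := Ordinal m0.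
have CA : A = C.+1 :> nat by rewrite /=; lia.
have [p [q [pq qk sE]]] := sigmaP kn.
(* The bound on [k] keeps [sigma m.+2 k] away from the three last points, on which the last two
   generators act. *)
have sD (r : 'I_m.+2) : m.-1 <= r -> sigma m.+2 k r = r.
  by move=> mr; rewrite sE tpermD //; apply/eqP => E; move: mr; rewrite -E; lia.
have sV : (sigma m.+2 k)^-1%g = sigma m.+2 k by rewrite sE tpermV.
have AC : A != C by apply/eqP => /(congr1 val) /=; lia.
have BC : B != C by apply/eqP => /(congr1 val) /=; lia.
(* Up to the factor [sigma m.+2 k], [x] and [y] are the atoms of the copy of the symmetric group on
   the three last points, and [c] and [d] are its two elements of length two. *)
pose x := (sigma m.+2 k * tperm A B)%g; pose y := (sigma m.+2 k * tperm C A)%g.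
pose c := (x * tperm C A)%g; pose d := (y * tperm A B)%g.
have rS i j : i < m.+2 -> rk (sigma m.+2 k) i j = i - j + ((i == k) && (j == k)).
  by move=> li; apply: rk_sigma => //; apply: ltnW.
have rx i j : i < m.+2 ->
    rk x i j = if j == m.+1 then nat_of_bool (m < i) else rk (sigma m.+2 k) i j.
  move=> li; case: (@eqP _ j m.+1) => [->|/eqP jm]; last by rewrite /x (rk_mulr AB).
  by rewrite /x (rk_mulr_eq AB _ i) rk_out // sV sD //=; lia.
have ry i j : i < m.+2 ->
    rk y i j = if j == m then nat_of_bool (m.-1 < i) else rk (sigma m.+2 k) i j.
  move=> li; case: (@eqP _ j m) => [->|/eqP jm]; last by rewrite /y (rk_mulr CA).
  by rewrite /y (rk_mulr_eq CA _ i) rS //= sV sD //=; lia.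
have rc i j : i < m.+2 ->
    rk c i j = if j == m then (m < i) + (m.-1 < i) else rk x i j.
  move=> li; case: (@eqP _ j m) => [->|/eqP jm]; last by rewrite /c (rk_mulr CA).
  rewrite /c (rk_mulr_eq CA _ i) rx //= eqxx; congr (_ + (_ < _)).
  by rewrite invMg tpermV sV permM tpermD // sD.
have rd i j : i < m.+2 ->
    rk d i j = if j == m.+1 then nat_of_bool (m.-1 < i) else rk y i j.
  move=> li; case: (@eqP _ j m.+1) => [->|/eqP jm]; last by rewrite /d (rk_mulr AB).
  rewrite /d (rk_mulr_eq AB _ i) rk_out // add0n; congr (nat_of_bool (_ < _)).
  by rewrite invMg tpermV sV permM tpermR sD.
have mS : (m == m.+1) = false by lia.
have Sm : (m.+1 == m) = false by lia.
have xc : rle x c.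
  apply: rle_bounded => i j li _; rewrite rc //; case: (j =P m) => [->|//].
  by rewrite rx // mS rS //; lia.
have xd : rle x d.
  apply: rle_bounded => i j li _; rewrite rd // rx //; case: (j =P m.+1) => [_|_]; first by lia.
  by rewrite ry //; case: (j =P m) => [->|//]; rewrite rS //; lia.
have yc : rle y c.
  apply: rle_bounded => i j li _; rewrite rc // ry //; case: (j =P m) => [_|_]; first by lia.
  by rewrite rx //; case: (j =P m.+1) => [->|//]; rewrite rS //; lia.
have yd : rle y d.
  apply: rle_bounded => i j li _; rewrite rd //; case: (j =P m.+1) => [->|//].
  by rewrite ry // Sm rS //; lia.
(* The hypotheses put both largest values of [w] among its first [m.+1] places, and the largest even
   among the first [m]. This makes the ranks of [w] large enough wherever [c] or [d] exceeds
   [sigma m.+2 k]. *)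
have wm i : i < m.+2 -> rk w i m.+1 = (w^-1%g B < i).
  by move=> li; rewrite (rkSr w i B) rk_out.
have wSm : rk w m.+1 m = 2.
  have := rkSl w B m; rewrite rk_full // [A <= _]leqNgt wB addn0 => <-.
  by rewrite -addn2 addKn.
have wmm : 0 < rk w m m.
  by apply: leq_trans (rk_anti w m (leqnSn m)); rewrite wm ?wBV.
have Sw : rle (sigma m.+2 k) w by apply/(rle_sigma w kn).
have cw : rle c w.
  apply: rle_bounded => i j li _; rewrite rc // rx //; case: (j =P m) => [->|_].
    case: (ltngtP i m) => [|im|->]; [by lia | | by lia].
    have -> : i = m.+1 by lia.
    by rewrite wSm; apply: (leq_add (leq_b1 _) (leq_b1 _)).
  case: (j =P m.+1) => [->|_]; last exact: Sw.
  by rewrite wm //; lia.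
have dw : rle d w.
  apply: rle_bounded => i j li _; rewrite rd // ry //; case: (j =P m.+1) => [->|_].
    by rewrite wm //; lia.
  case: (j =P m) => [->|_]; last exact: Sw.
  case: (ltngtP i m) => [|im|->]; [by lia | | by lia].
  have -> : i = m.+1 by lia.
  by rewrite wSm; apply: leq_trans (leq_b1 _) _.
have kS : rk (sigma m.+2 k) k k = 1 by rewrite rS ?eqxx; lia.
have kx : 0 < rk x k k by rewrite rx ?kS; [case: eqP; lia|lia].
have ky : 0 < rk y k k by rewrite ry ?kS; [case: eqP; lia|lia].
have xI : x \in atom_interval k w.
  by apply/atom_intervalP; split=> //; apply: rle_trans cw.
have yI : y \in atom_interval k w.
  by apply/atom_intervalP; split=> //; apply: rle_trans cw.
have cI : c \in atom_interval k w.
  by apply/atom_intervalP; split=> //; apply: leq_trans kx (xc k k).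
have dI : d \in atom_interval k w.
  by apply/atom_intervalP; split=> //; apply: leq_trans kx (xd k k).
(* By the ranks, [z] has the value [m] among its first [m] places, and [m.+1]
   as only value [>= m] among its first [m.+1] places. *)
have [_ [z [_ xz yz zlub]]] := L x y xI yI.
have := zlub c cI xc yc m m.+1; rewrite rc // Sm rx // eqxx ltnn.
have := zlub d dI xd yd m.+1 m; rewrite rd // mS ry // eqxx.
have := xz m.+1 m.+1; rewrite rx // eqxx ltnSn.
have := yz m m; rewrite ry // eqxx.
have := rkSr z m A; have := rkSr z m.+1 A => /=.
by move: (z^-1%g A : nat) => q'; lia.
Qed.

End Peel.

(** * Permutations as rank tables *)

(* The tests are nested by [if] and not by the boolean connectives: these are
   functions, whose second argument is always computed by call by value. *)
Fixpoint is_inter (r r' m : seq bool) : bool :=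
  match r, r', m with
  | a :: r, b :: r', c :: m => if (a && b) == c then is_inter r r' m else false
  | [::], [::], [::] => true
  | _, _, _ => false
  end.

Fixpoint exists_if (T : Type) (P : pred T) (s : seq T) : bool :=
  if s is x :: s' then if P x then true else exists_if P s' else false.

(** The rows of [D] are the characteristic vectors of principal down-sets. Two elements have a meet
    exactly when the intersection of their rows is again a row. *)
Definition has_meets (T : Type) (le : rel T) (s : seq T) : bool :=
  let D := [seq [seq le z x | z <- s] | x <- s] in
  all (fun r => all (fun r' => exists_if (is_inter r r') D) D) D.

Lemma is_inter_map (T : Type) (f g h : pred T) (s : seq T) :
  is_inter (map f s) (map g s) (map h s) = all (fun z => (f z && g z) == h z) s.
Proof. by elim: s => //= z s ->; case: eqP. Qed.

Lemma exists_ifE (T : Type) (P : pred T) (s : seq T) : exists_if P s = has P s.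
Proof. by elim: s => //= x s ->; case: (P x). Qed.

Lemma has_meetsP (T : eqType) (le : rel T) (s : seq T) : has_meets le s ->
  {in s &, forall x y, exists2 m, m \in s & {in s, forall z, le z m = le z x && le z y}}.
Proof.
move=> /allP H x y xs ys.
have /allP/(_ _ (map_f _ ys)) := H _ (map_f _ xs).
rewrite exists_ifE => /hasP[_ /mapP[m ms ->]]; rewrite is_inter_map => /allP E.
by exists m => // z /E /eqP.
Qed.

Section Model.

Variable n : nat.
Implicit Types (v w : 'S_n) (s t : seq nat) (M : seq nat).

Definition one_line w : seq nat := [seq val (w x) | x <- enum 'I_n].

Definition rank_table s : seq nat :=
  [seq count (leq p.2) (take p.1 s) | p <- allpairs pair (iota 0 n) (iota 0 n)].

Definition table w := rank_table (one_line w).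

Definition tle : rel (seq nat) := all2 leq.

Definition tables k : seq (seq nat) :=
  [seq rank_table s | s <- permutations (iota 0 n) & 0 < count (leq k) (take k s)].

Definition tinterval k M := [seq N <- tables k | tle N M].

Definition lattice_table k M : bool :=
  (M \in tables k) && has_meets tle (tinterval k M).

(* [b] lists the tables of [w], [x], [y], [c] and [d], where [c] and [d] are upper
   bounds below [w] of [x] and [y], which have no join below both. *)
Definition bowtie_table k (b : seq (seq nat)) : bool :=
  if b is [:: M; x; y; c; d] then
    [&& all [in tables k] b, tle x c, tle x d, tle y c, tle y d, tle c M, tle d M
      & all (fun z => ~~ [&& tle x z, tle y z, tle z c & tle z d]) (tables k)]
  else false.

(** A certificate: [gs] are tops of lattices, [bs] are obstructions, and every table lies below one
    of the former or above one of the latter. *)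
Definition classified k (gs : seq (seq nat)) (bs : seq (seq (seq nat))) : bool :=
  [&& all (lattice_table k) gs, all (bowtie_table k) bs
    & all (fun M => has (tle M) gs || has (fun b => tle (head [::] b) M) bs) (tables k)].

Lemma size_one_line w : size (one_line w) = n.
Proof. by rewrite size_map size_enum_ord. Qed.

Lemma count_one_line w i j : i <= n -> count (leq j) (take i (one_line w)) = rk w i j.
Proof.
elim: i => [|i IH] lin; first by rewrite take0 rk_0.
rewrite (take_nth 0) ?size_one_line // -cats1 count_cat IH 1?ltnW //=.
rewrite (rkSl w (Ordinal lin)) addn0; congr (_ + (_ <= _)).
rewrite (nth_map (Ordinal lin)) ?size_enum_ord //; congr (val (w _)).
by apply: val_inj; rewrite /= nth_enum_ord.
Qed.

Lemma tleP v w : reflect (rle v w) (tle (table v) (table w)).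
Proof.
have E (T : Type) (f g : T -> nat) l :
    tle (map f l) (map g l) = all (fun x => f x <= g x) l.
  by elim: l => //= x l ->.
rewrite E; apply: (iffP allP) => [H|vw [i j] /allpairsP[[i' j'] /=]].
  apply: rle_bounded => i j lin ljn; have := H (i, j).
  rewrite !count_one_line ?(ltnW lin) //; apply.
  by apply/allpairsP; exists (i, j); rewrite !mem_iota.
rewrite !mem_iota /= add0n => -[lin _ [-> _]].
by rewrite !count_one_line ?(ltnW lin).
Qed.

Lemma table_inj : injective table.
Proof.
have R w : tle (table w) (table w) by apply/tleP/rle_refl.
by move=> v w E; apply: rle_anti; apply/tleP; rewrite E.
Qed.

(** The map [one_line] is injective into the list of permutations, and both sides have [n] factorial
    members. *)
Lemma perm_one_line : perm_eq (map one_line (enum {: 'S_n})) (permutations (iota 0 n)).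
Proof.
have one_line_inj : injective one_line.
  by move=> v w E; apply: table_inj; rewrite /table E.
have U : uniq (map one_line (enum {: 'S_n})) by rewrite map_inj_uniq ?enum_uniq.
have [| |_ E] := uniq_min_size (s2 := permutations (iota 0 n)) U.
- move=> _ /mapP[w _ ->]; rewrite mem_permutations; apply: uniq_perm.
  + by rewrite map_inj_uniq ?enum_uniq // => x y /val_inj/perm_inj.
  + exact: iota_uniq.
  move=> i; rewrite mem_iota /= add0n; apply/mapP/idP => [[x _ ->]|lin].
    exact: ltn_ord.
  by exists (w^-1%g (Ordinal lin)); rewrite ?mem_enum ?permKV.
- rewrite size_permutations ?iota_uniq // size_iota size_map -cardE.
  by rewrite -card_Sn; apply: eq_leq; apply: eq_card => w; rewrite !inE.
by apply: uniq_perm => //; apply: permutations_uniq.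
Qed.

Lemma tablesP k M : k <= n ->
  reflect (exists2 w, 0 < rk w k k & M = table w) (M \in tables k).
Proof.
move=> kn; apply: (iffP mapP) => [[s]|[w wk ->]].
  rewrite mem_filter -(perm_mem perm_one_line) => /andP[sk /mapP[w _ E]] ->.
  by exists w; [rewrite -count_one_line // -E|rewrite /table -E].
exists (one_line w) => //; rewrite mem_filter count_one_line // wk.
by rewrite -(perm_mem perm_one_line) map_f // mem_enum.
Qed.

Lemma mem_tinterval k u w : k <= n ->
  (table u \in tinterval k (table w)) = (u \in atom_interval k w).
Proof.
move=> kn; rewrite mem_filter andbC; apply/andP/atom_intervalP.
  by case=> /tablesP-/(_ kn)[u' u'k /table_inj ->] /tleP.
by case=> uk uw; split; [apply/tablesP => //; exists u|apply/tleP].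
Qed.

Lemma tintervalP k w M : k <= n -> M \in tinterval k (table w) ->
  exists2 u, u \in atom_interval k w & M = table u.
Proof.
move=> kn MI; have := MI; rewrite mem_filter => /andP[_ /tablesP-/(_ kn)[u _ Mu]].
by exists u; rewrite -?mem_tinterval // -Mu.
Qed.

(** Only meets are tested; joins follow as the interval has a top. *)
Lemma lattice_tableP k w : k <= n ->
  lattice_table k (table w) -> w \in atom_lattices n k.
Proof.
move=> kn /andP[/tablesP-/(_ kn)[w' wk /table_inj E] /has_meetsP meets].
apply/atom_latticesP; rewrite E; split=> //; rewrite -{}E in wk *.
apply: (@meets_is_lattice _ _ _ w); [exact: rle_trans|exact: atom_interval_top| |].
  by move=> x /atom_intervalP[].
move=> x y; rewrite -!mem_tinterval // => xI yI.
have [M MI meet] := meets _ _ xI yI; have [m mI Mm] := tintervalP kn MI.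
exists m; rewrite {M}Mm in MI meet.
have := meet _ MI; rewrite (introT (tleP m m) (rle_refl m)) => /esym/andP[/tleP mx /tleP my].
split=> // z; rewrite -mem_tinterval // => zI /tleP zx /tleP zy.
by apply/tleP; rewrite meet // zx zy.
Qed.

(** A join of the second and third members would lie below the last two. The failure at the head
    passes to every larger [w], since the lattice property passes downwards. *)
Lemma bowtie_tableP k b w : k <= n -> bowtie_table k b ->
  tle (head [::] b) (table w) -> w \notin atom_lattices n k.
Proof.
move=> kn; case: b => [|M [|X [|Y [|C [|D []]]]]] //= /andP[].
rewrite /= => /and5P[/tablesP-/(_ kn)[u uk ->]].
move=> /tablesP-/(_ kn)[x xk ->] /tablesP-/(_ kn)[y yk ->].
move=> /tablesP-/(_ kn)[c ck ->] /andP[/tablesP-/(_ kn)[d dk ->] _].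
move=> /and5P[/tleP xc /tleP xd /tleP yc /tleP yd /and3P[/tleP cu /tleP du /allP none]].
move=> /tleP uw; apply/negP => L.
have /atom_latticesP[_] : u \in atom_lattices n k by apply: atom_lattices_down uw.
move=> /(_ x y)[].
- by apply/atom_intervalP; split=> //; apply: rle_trans cu.
- by apply/atom_intervalP; split=> //; apply: rle_trans cu.
move=> _ [z [/atom_intervalP[zk _] xz yz zlub]].
have /negP[] : ~~ [&& tle (table x) (table z), tle (table y) (table z),
    tle (table z) (table c) & tle (table z) (table d)].
  by apply: none; apply/tablesP => //; exists z.
apply/and4P; split; apply/tleP => //.
  by apply: zlub => //; apply/atom_intervalP.
by apply: zlub => //; apply/atom_intervalP.
Qed.

Lemma card_classified k gs bs : k <= n -> classified k gs bs ->
  #|atom_lattices n k| = count (fun M => has (tle M) gs) (tables k).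
Proof.
move=> kn /and3P[/allP good /allP bad /allP all_cases].
rewrite cardE /enum_mem size_filter /tables [in RHS]count_map count_filter.
rewrite -(seq.permP perm_one_line) [in RHS]count_map -enumT; apply: eq_count => w /=.
rewrite -/(table w) count_one_line //; apply/idP/andP => [wL|[/hasP[g gG wg] wk]].
  have /atom_latticesP[wk _] := wL; split=> //.
  have wT : table w \in tables k by apply/tablesP => //; exists w.
  have /orP[//|/hasP[b bB bw]] := all_cases _ wT.
  by have := bowtie_tableP kn (bad b bB) bw; rewrite wL.
have /andP[/tablesP-/(_ kn)[g' _ E] _] := good g gG.
apply: (@atom_lattices_down _ _ _ g') => //; last by apply/tleP; rewrite -E.
by apply: lattice_tableP; rewrite -?E ?good.
Qed.

End Model.

(** * Small cases *)

(* [gs] lists the maximal [w] for which the interval is a lattice, and [bs] the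
   minimal ones for which it is not, with their bowties. *)
Lemma card_atom_lattices_3_1 : #|atom_lattices 3 1| = 4.
Proof.
pose gs : seq (seq nat) :=
  [:: [:: 2; 1; 0]].
pose bs : seq (seq (seq nat)) := [::].
have C : classified 3 1 (map (rank_table 3) gs) (map (map (rank_table 3)) bs).
  by vm_cast_no_check isT.
rewrite (card_classified _ C); [by vm_cast_no_check (erefl 4)|exact: isT].
Qed.

Lemma card_atom_lattices_4_1 : #|atom_lattices 4 1| = 12.
Proof.
pose gs : seq (seq nat) :=
  [:: [:: 2; 1; 3; 0]; [:: 2; 3; 0; 1]; [:: 3; 1; 0; 2]].
pose bs : seq (seq (seq nat)) :=
  [:: [:: [:: 1; 3; 2; 0]; [:: 1; 0; 3; 2]; [:: 1; 2; 0; 3];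
      [:: 1; 2; 3; 0]; [:: 1; 3; 0; 2]];
    [:: [:: 3; 0; 2; 1]; [:: 1; 0; 3; 2]; [:: 2; 0; 1; 3];
      [:: 2; 0; 3; 1]; [:: 3; 0; 1; 2]]].
have C : classified 4 1 (map (rank_table 4) gs) (map (map (rank_table 4)) bs).
  by vm_cast_no_check isT.
rewrite (card_classified _ C); [by vm_cast_no_check (erefl 12)|exact: isT].
Qed.

Lemma card_atom_lattices_4_2 : #|atom_lattices 4 2| = 17.
Proof.
pose gs : seq (seq nat) :=
  [:: [:: 2; 3; 0; 1]; [:: 3; 1; 2; 0]].
pose bs : seq (seq (seq nat)) :=
  [:: [:: [:: 2; 3; 1; 0]; [:: 0; 2; 3; 1]; [:: 1; 2; 0; 3];
      [:: 1; 2; 3; 0]; [:: 2; 3; 0; 1]];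
    [:: [:: 3; 2; 0; 1]; [:: 0; 3; 1; 2]; [:: 2; 0; 1; 3];
      [:: 2; 3; 0; 1]; [:: 3; 0; 1; 2]]].
have C : classified 4 2 (map (rank_table 4) gs) (map (map (rank_table 4)) bs).
  by vm_cast_no_check isT.
rewrite (card_classified _ C); [by vm_cast_no_check (erefl 17)|exact: isT].
Qed.

Lemma card_atom_lattices_5_2 : #|atom_lattices 5 2| = 51.
Proof.
pose gs : seq (seq nat) :=
  [:: [:: 2; 3; 0; 4; 1]; [:: 2; 4; 0; 1; 3]; [:: 3; 1; 2; 4; 0];
    [:: 3; 1; 4; 0; 2]; [:: 4; 1; 2; 0; 3]].
pose bs : seq (seq (seq nat)) :=
  [:: [:: [:: 0; 2; 4; 3; 1]; [:: 0; 2; 1; 4; 3]; [:: 0; 2; 3; 1; 4];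
      [:: 0; 2; 3; 4; 1]; [:: 0; 2; 4; 1; 3]];
    [:: [:: 0; 4; 1; 3; 2]; [:: 0; 2; 1; 4; 3]; [:: 0; 3; 1; 2; 4];
      [:: 0; 3; 1; 4; 2]; [:: 0; 4; 1; 2; 3]];
    [:: [:: 2; 3; 1; 0; 4]; [:: 0; 2; 3; 1; 4]; [:: 1; 2; 0; 3; 4];
      [:: 1; 2; 3; 0; 4]; [:: 2; 3; 0; 1; 4]];
    [:: [:: 3; 2; 0; 1; 4]; [:: 0; 3; 1; 2; 4]; [:: 2; 0; 1; 3; 4];
      [:: 2; 3; 0; 1; 4]; [:: 3; 0; 1; 2; 4]]].
have C : classified 5 2 (map (rank_table 5) gs) (map (map (rank_table 5)) bs).
  by vm_cast_no_check isT.
rewrite (card_classified _ C); [by vm_cast_no_check (erefl 51)|exact: isT].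
Qed.

Lemma card_atom_lattices_6_3 : #|atom_lattices 6 3| = 153.
Proof.
pose gs : seq (seq nat) :=
  [:: [:: 5; 0; 2; 3; 1; 4]; [:: 1; 3; 4; 0; 5; 2]; [:: 1; 3; 5; 0; 2; 4];
    [:: 1; 4; 2; 3; 5; 0]; [:: 1; 4; 2; 5; 0; 3]; [:: 1; 5; 2; 3; 0; 4];
    [:: 2; 4; 0; 3; 5; 1]; [:: 2; 4; 0; 5; 1; 3]; [:: 2; 5; 0; 3; 1; 4];
    [:: 3; 0; 4; 1; 5; 2]; [:: 3; 0; 5; 1; 2; 4]; [:: 4; 0; 2; 3; 5; 1];
    [:: 4; 0; 2; 5; 1; 3]].
pose bs : seq (seq (seq nat)) :=
  [:: [:: [:: 0; 1; 3; 5; 4; 2]; [:: 0; 1; 3; 2; 5; 4]; [:: 0; 1; 3; 4; 2; 5];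
      [:: 0; 1; 3; 4; 5; 2]; [:: 0; 1; 3; 5; 2; 4]];
    [:: [:: 0; 1; 5; 2; 4; 3]; [:: 0; 1; 3; 2; 5; 4]; [:: 0; 1; 4; 2; 3; 5];
      [:: 0; 1; 4; 2; 5; 3]; [:: 0; 1; 5; 2; 3; 4]];
    [:: [:: 0; 3; 4; 2; 1; 5]; [:: 0; 1; 3; 4; 2; 5]; [:: 0; 2; 3; 1; 4; 5];
      [:: 0; 2; 3; 4; 1; 5]; [:: 0; 3; 4; 1; 2; 5]];
    [:: [:: 0; 4; 3; 1; 2; 5]; [:: 0; 1; 4; 2; 3; 5]; [:: 0; 3; 1; 2; 4; 5];
      [:: 0; 3; 4; 1; 2; 5]; [:: 0; 4; 1; 2; 3; 5]];
    [:: [:: 2; 1; 3; 0; 4; 5]; [:: 0; 2; 3; 1; 4; 5]; [:: 1; 0; 3; 2; 4; 5];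
      [:: 1; 2; 3; 0; 4; 5]; [:: 2; 0; 3; 1; 4; 5]];
    [:: [:: 3; 1; 0; 2; 4; 5]; [:: 0; 3; 1; 2; 4; 5]; [:: 1; 0; 3; 2; 4; 5];
      [:: 1; 3; 0; 2; 4; 5]; [:: 3; 0; 1; 2; 4; 5]]].
have C : classified 6 3 (map (rank_table 6) gs) (map (map (rank_table 6)) bs).
  by vm_cast_no_check isT.
rewrite (card_classified _ C); [by vm_cast_no_check (erefl 153)|exact: isT].
Qed.

(** * Counting *)

Lemma card_atom_lattices_rec m k : 0 < k -> k < m ->
  #|atom_lattices m.+3 k| + #|atom_lattices m.+1 k| = 3 * #|atom_lattices m.+2 k|.
Proof.
move=> k0 km; have kmS : k <= m.+1 by lia.
have km' : k <= m by lia.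
set s := last_adj m.+1; set L := atom_lattices m.+2 k.
have pE : penult m.+1 = lift ord_max ord_max.
  by apply: val_inj; rewrite /= /bump ltnn.
have sB : s ord_max = penult m.+1 by apply: tpermR.
have sA : s (penult m.+1) = ord_max by apply: tpermL.
pose X := @emb m.+2 @: L; pose Y := [set (emb u * s)%g | u in L].
pose Z := [set (s * emb u)%g | u in L].
have XYZ : atom_lattices m.+3 k = X :|: (Y :|: Z).
  apply/setP => w; rewrite !in_setU; apply/idP/or3P => [wL|]; last first.
    by case=> /imsetP[u uL ->]; rewrite ?emb_atom_lattices ?peelr_atom_lattices
      ?peell_atom_lattices //.
  (* If neither the last place nor the place of the last value is among the last two,
     [not_lattice_far] applies; [k < m] is the bound on [k] that it asks for. *)
  case: (leqP (penult m.+1) (w ord_max)) => [/peelr_onto[u [[]]]|wB].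
  - move=> wE; move: wL; rewrite wE peelr_atom_lattices //.
    by constructor 2; apply: imset_f.
  - move=> wE; move: wL; rewrite wE emb_atom_lattices //.
    by constructor 1; apply: imset_f.
  case: (leqP (penult m.+1) (w^-1%g ord_max)) => [/peell_onto[u [[]]]|wBV].
  - move=> wE; move: wL; rewrite wE peell_atom_lattices //.
    by constructor 3; apply: imset_f.
  - move=> wE; move: wL; rewrite wE emb_atom_lattices //.
    by constructor 1; apply: imset_f.
  by have := @not_lattice_far m.+1 k w k0 km wB wBV; rewrite wL.
have XdYZ : X :&: (Y :|: Z) = set0.
  apply/setP => w; rewrite !inE; apply/negP => /andP[/imsetP[u _ ->]].
  (* Elements of [X] fix the last point, those of [Y] and [Z] do not. *)
  case/orP=> /imsetP[v _ /permP/(_ ord_max)]; rewrite !permM !emb_max ?sB.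
    by move/(congr1 val) => /=; lia.
  by rewrite -{1}(emb_max v) => /perm_inj /(congr1 val) /=; lia.
have YZ : Y :&: Z = [set (emb (emb u) * s)%g | u in atom_lattices m.+1 k].
  apply/setP => w; rewrite inE; apply/andP/imsetP => [[/imsetP[u uL ->]]|[u uL ->]].
    (* Evaluation at the last but one point shows that [u] fixes its own last point. *)
    case/imsetP => v _ /permP/(_ (penult m.+1)).
    rewrite !permM sA emb_max -{1}sA => /perm_inj.
    rewrite pE lift_perm_lift => /lift_inj /emb_onto[u' E].
    by exists u'; rewrite -?E // -(@emb_atom_lattices m k) -?E.
  have uL' : emb u \in L by rewrite emb_atom_lattices.
  split; first exact: imset_f.
  (* The generator [s] commutes with a permutation that fixes both points it moves. *)
  apply/imsetP; exists (emb u) => //; rewrite [RHS]conjgC; congr (_ * _)%g.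
  by rewrite tpermJ emb_max pE lift_perm_lift emb_max -pE.
have cX : #|X| = #|L| by apply/card_imset/emb_inj.
have cY : #|Y| = #|L| by apply/card_imset => u v /mulIg /emb_inj.
have cZ : #|Z| = #|L| by apply/card_imset => u v /mulgI /emb_inj.
have cYZ : #|Y :&: Z| = #|atom_lattices m.+1 k|.
  by rewrite YZ; apply/card_imset => u v /mulIg /emb_inj /emb_inj.
have := cardsUI X (Y :|: Z); have := cardsUI Y Z.
rewrite XdYZ cards0 -XYZ cX cY cZ cYZ.
by move: #|atom_lattices m.+3 k| #|L| #|atom_lattices m.+1 k| #|Y :|: Z| => *; lia.
Qed.

(** * Fibonacci identities and the closed form *)

Lemma fibSS n : fib n.+2 = fib n.+1 + fib n. Proof. by []. Qed.

Lemma fib_add m n : fib (m + n).+1 = fib m.+1 * fib n.+1 + fib m * fib n.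
Proof.
elim/ltn_ind: m => -[|[|m]] IH; rewrite ?add0n ?add1n ?mul1n ?mul0n ?addn0 //.
have := IH m.+1 (leqnn _); have := IH m (leqnSn _).
by rewrite !addSn !fibSS => -> ->; lia.
Qed.

Lemma fib_even_rec j : fib (2 * j.+2) + fib (2 * j) = 3 * fib (2 * j.+1).
Proof. by rewrite !mulnS !addSn !add0n !fibSS; lia. Qed.

Lemma rec_unique (u v : nat -> nat) :
    (forall j, u j.+2 + u j = 3 * u j.+1) -> (forall j, v j.+2 + v j = 3 * v j.+1) ->
  u 0 = v 0 -> u 1 = v 1 -> u =1 v.
Proof.
move=> ru rv u0 u1 j; suff [] : u j = v j /\ u j.+1 = v j.+1 by [].
by elim: j => // j [ej ejS]; split=> //; have := ru j; have := rv j; lia.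
Qed.

(** With [m] in the role of [n - k], conjugation by the longest element becomes symmetry in the
    arguments. *)
Definition lattice_count k m := #|atom_lattices (k + m) k|.

Lemma lattice_countC k m : lattice_count k m = lattice_count m k.
Proof.
by rewrite /lattice_count -card_atom_lattices_sym ?leq_addr // addKn addnC.
Qed.

Lemma lattice_count_rec k m : 0 < k ->
  lattice_count k m.+4 + lattice_count k m.+2 = 3 * lattice_count k m.+3.
Proof.
move=> k0; rewrite /lattice_count !addnS; apply: card_atom_lattices_rec => //.
by rewrite ltnS leq_addr.
Qed.

(** Even-indexed Fibonacci numbers satisfy the same recurrence and start with 1 and 3 at the indices
    2 and 4. *)
Lemma lattice_count_row k c : 0 < k ->
    lattice_count k 2 = c -> lattice_count k 3 = 3 * c ->
  forall m, lattice_count k m.+2 = c * fib (2 * m.+1).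
Proof.
move=> k0 c2 c3; apply: rec_unique => [j|j||]; first exact: lattice_count_rec.
- by have := fib_even_rec j.+1; nia.
- by rewrite c2 (_ : fib (2 * 1) = 1) // muln1.
by rewrite c3 (_ : fib (2 * 2) = 3) // mulnC.
Qed.

Lemma lattice_count_1 m : lattice_count 1 m.+2 = 4 * fib (2 * m.+1).
Proof. exact: (@lattice_count_row 1 4 isT card_atom_lattices_3_1 card_atom_lattices_4_1). Qed.

Lemma lattice_count_2 m : lattice_count 2 m.+2 = 17 * fib (2 * m.+1).
Proof. exact: (@lattice_count_row 2 17 isT card_atom_lattices_4_2 card_atom_lattices_5_2). Qed.

Lemma lattice_count_3 m : lattice_count 3 m.+2 = 51 * fib (2 * m.+1).
Proof.
apply: (@lattice_count_row 3 51 isT _ card_atom_lattices_6_3).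
by rewrite lattice_countC lattice_count_2.
Qed.

(** By symmetry the rows 2 and 3 supply the two initial values of every other row. *)
Lemma lattice_count_inner k m :
  lattice_count k.+2 m.+2 = 17 * fib (2 * k.+1) * fib (2 * m.+1).
Proof.
apply: lattice_count_row => //.
  by rewrite lattice_countC lattice_count_2.
by rewrite lattice_countC lattice_count_3 mulnA.
Qed.

Theorem corollary5p6 (n k : nat) (hn : 3 < n) (hk : 0 < k < n) :
  #|lattice_intervals_from (sigma n k)| =
    if (k == 1) || (k == n - 1) then 4 * fib (2 * n - 4)
    else 16 * fib (2 * k - 2) * fib (2 * (n - k) - 2) + fib (2 * n - 5)
           - fib (2 * k - 3) * fib (2 * (n - k) - 3).
Proof.
rewrite card_lattice_intervals //.
have -> : #|atom_lattices n k| = lattice_count k (n - k).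
  by rewrite /lattice_count subnKC //; case/andP: hk => _ /ltnW.
case: ifP => [k_end|/negbT k_mid].
  have -> : lattice_count k (n - k) = lattice_count 1 (n - 3).+2.
    case/orP: k_end => /eqP->; first by congr (lattice_count _ _); lia.
    by rewrite lattice_countC; congr (lattice_count _ _); lia.
  by rewrite lattice_count_1; congr (4 * fib _); lia.
have [i ki] : exists i, k = i.+2 by exists (k - 2); lia.
have [j nj] : exists j, n - k = j.+2 by exists (n - k - 2); lia.
rewrite nj ki lattice_count_inner.
(* With [k = i.+2] and [n - k = j.+2], the addition formula splits this Fibonacci number into two
   products. One raises the coefficient 16 to 17, the other is exactly what is subtracted, so the
   subtraction is not truncated. *)
have -> : 2 * n - 5 = (2 * i + 1 + (2 * j + 1)).+1 by lia.
rewrite fib_add -!(addn1 (2 * _ + 1)).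
have -> : 2 * i.+2 - 2 = 2 * i + 1 + 1 by lia.
have -> : 2 * j.+2 - 2 = 2 * j + 1 + 1 by lia.
have -> : 2 * i.+2 - 3 = 2 * i + 1 by lia.
have -> : 2 * j.+2 - 3 = 2 * j + 1 by lia.
have -> : 2 * i.+1 = 2 * i + 1 + 1 by lia.
have -> : 2 * j.+1 = 2 * j + 1 + 1 by lia.
by rewrite addnA addnK -mulnA -mulnA; lia.
Qed.
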